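(* Let $E$ be a Banach lattice and let $\varphi$ be an Orlicz function satisfying the $\Delta_2$-condition and admitting a complementary function. Then $\ell^\pi_\varphi(E)\setminus\ell^s_\varphi(E)$ is either empty or completely latticeable in $\ell^\pi_\varphi(E)$.
   Context: Complete latticeability. A subset $A$ of a Banach lattice $X$ is completely latticeable (in $X$) if there is a closed infinite dimensional sublattice (Riesz subspace) of $X$ all of whose elements but the origin belong to $A$. Orlicz sequence spaces (conventions of Lindenstrauss–Tzafriri, Classical Banach Spaces I, written out here in full). An Orlicz function $\varphi\colon[0,\infty)\to[0,\infty)$ is a continuous, non-decreasing convex function with $\varphi(0)=0$ and $\lim_{t\to\infty}\varphi(t)=\infty$. It satisfies the $\Delta_2$-condition (at zero) if $\varphi(t)>0$ for $t>0$ and $\limsup_{t\to0^+}\varphi(2t)/\varphi(t)<\infty$. It admits a complementary function if its right derivative $p$ satisfies $p(0)=0$ and $\lim_{t\to\infty}p(t)=\infty$; the complementary function is then $\varphi^*(u)=\max_{t\ge0}(tu-\varphi(t))$. The Orlicz sequence space $\ell_\varphi$ consists of all $(a_j)_j\in\mathbb{R}^{\mathbb{N}}$ with $\sum_j\varphi(|a_j|/\rho)<\infty$ for some $\rho>0$, with norm $\|(a_j)_j\|=\inf\{\rho>0:\sum_j\varphi(|a_j|/\rho)\le1\}$ and the coordinatewise order. Vector-valued sequence spaces. Put $\lambda=\ell_\varphi$, with Köthe dual $$\lambda'=\Big\{(b_j)_j\in\mathbb{R}^{\mathbb{N}}:\ \sum_{j=1}^\infty|a_jb_j|<\infty\ \text{for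 every } (a_j)_j\in\lambda\Big\},\quad \|(b_j)_j\|_{\lambda'}=\sup_{(a_j)_j\in B_\lambda}\Big|\sum_{j=1}^\infty a_jb_j\Big|,$$ where $B_X$ denotes the closed unit ball of $X$. For a Banach lattice $E$: $$\lambda'_w(E^* )=\{(x^*_j)_j\in(E^* )^{\mathbb{N}}:(x^*_j(x))_j\in\lambda'\ \text{for every }x\in E\},$$ $$\ell_\varphi^s(E):=\lambda_s(E)=\Big\{(x_j)_j\in E^{\mathbb{N}}:\sum_{j=1}^\infty|x^*_j(x_j)|<\infty\ \text{for every }(x^*_j)_j\in\lambda'_w(E^* )\Big\},$$ $$\lambda'_\varepsilon(E^* )=\{(x^*_j)_j\in(E^* )^{\mathbb{N}}:(|x^*_j|(x))_j\in\lambda'\ \text{for every }x\in E^+\},\quad \|(x^*_j)_j\|_\varepsilon=\sup_{x\in B_{E^+}}\|(|x^*_j|(x))_j\|_{\lambda'},$$ $$\ell_\varphi^\pi(E):=\lambda_\pi(E)=\Big\{(x_j)_j\in E^{\mathbb{N}}:\sum_{j=1}^\infty x^*_j(|x_j|)<\infty\ \text{for every }(x^*_j)_j\in\lambda'_\varepsilon(E^* )^+\Big\},$$ $$\|(x_j)_j\|_\pi=\sup_{(x^*_j)_j\in B_{\lambda'_\varepsilon(E^* )^+}}\sum_{j=1}^\infty x^*_j(|x_j|).$$ Here $X^+$ is the positive cone and $B_{X^+}=B_X\cap X^+$. The space $\ell_\varphi^\pi(E)$ is a Banach lattice with the coordinatewise order and the norm $\|\cdot\|_\pi$, and $\ell_\varphi^s(E)$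 is a linear subspace of it. *)

(* Defs.v *)
From HB Require Import structures.
From mathcomp Require Import all_boot all_order all_algebra.
From mathcomp Require Import all_classical all_reals all_analysis.

Set Implicit Arguments.
Unset Strict Implicit.
Unset Printing Implicit Defensive.

Import Order.TTheory GRing.Theory Num.Theory.
Import numFieldNormedType.Exports.

Local Open Scope classical_set_scope.
Local Open Scope ring_scope.

(* The order is a field of its own rather than a [porderType]: in the library
   the common substructures of orders and modules, and of orders and norms, are
   closed at the numeric domains, and Hierarchy Builder accepts no further
   structure joining them. *)
HB.mixin Record Lmodule_isRieszSpace (R : realType) V & GRing.Lmodule R V := {
  riesz_le : V -> V -> Prop ;
  riesz_le_refl : forall x : V, riesz_le x x ;
  riesz_le_anti : forall x y : V, riesz_le x y -> riesz_le y x -> x = y ;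
  riesz_le_trans : forall x y z : V,
    riesz_le x y -> riesz_le y z -> riesz_le x z ;
  riesz_leD : forall x y z : V, riesz_le x y -> riesz_le (x + z) (y + z) ;
  riesz_leZ : forall (a : R) (x y : V),
    0 <= a -> riesz_le x y -> riesz_le (a *: x) (a *: y) ;
  riesz_sup : V -> V -> V ;
  riesz_supP : forall x y z : V,
    riesz_le (riesz_sup x y) z <-> riesz_le x z /\ riesz_le y z ;
  riesz_inf : V -> V -> V ;
  riesz_infP : forall x y z : V,
    riesz_le z (riesz_inf x y) <-> riesz_le z x /\ riesz_le z y
}.

#[short(type="rieszSpaceType")]
HB.structure Definition RieszSpace (R : realType) :=
  {V of GRing.Lmodule R V & Lmodule_isRieszSpace R V}.

Notation "x <=r y" := (riesz_le x y) (at level 70, no associativity).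

Definition riesz_abs (R : realType) (V : rieszSpaceType R) (x : V) : V :=
  riesz_sup x (- x).

HB.mixin Record RieszSpace_Normed_isBanachLattice (R : realType) E
    & RieszSpace R E & CompleteNormedModule R E := {
  banach_lattice_norm : forall x y : E,
    riesz_abs x <=r riesz_abs y -> `|x| <= `|y|
}.

#[short(type="banachLatticeType")]
HB.structure Definition BanachLattice (R : realType) :=
  {E of RieszSpace R E & CompleteNormedModule R E
      & RieszSpace_Normed_isBanachLattice R E}.

Section SequencesRieszSpace.
Variables (R : realType) (V : rieszSpaceType R).
Implicit Types x y z : nat -> V.

Definition seq_le x y := forall j, x j <=r y j.
Definition seq_sup x y : nat -> V := fun j => riesz_sup (x j) (y j).
Definition seq_inf x y : nat -> V := fun j => riesz_inf (x j) (y j).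

Fact seq_le_refl x : seq_le x x.
Proof. by move=> j; exact: riesz_le_refl. Qed.

Fact seq_le_anti x y : seq_le x y -> seq_le y x -> x = y.
Proof. by move=> xy yx; apply/funext => j; exact: riesz_le_anti. Qed.

Fact seq_le_trans x y z : seq_le x y -> seq_le y z -> seq_le x z.
Proof. by move=> xy yz j; exact: riesz_le_trans (yz j). Qed.

Fact seq_leD x y z : seq_le x y -> seq_le (x + z) (y + z).
Proof. by move=> xy j; exact: riesz_leD. Qed.

Fact seq_leZ (a : R) x y : 0 <= a -> seq_le x y -> seq_le (a *: x) (a *: y).
Proof. by move=> a0 xy j; exact: riesz_leZ. Qed.

Fact seq_supP x y z : seq_le (seq_sup x y) z <-> seq_le x z /\ seq_le y z.
Proof.
split=> [xyz|[xz yz] j]; last exact/riesz_supP.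
by split=> j; have /riesz_supP[] := xyz j.
Qed.

Fact seq_infP x y z : seq_le z (seq_inf x y) <-> seq_le z x /\ seq_le z y.
Proof.
split=> [xyz|[zx zy] j]; last exact/riesz_infP.
by split=> j; have /riesz_infP[] := xyz j.
Qed.

HB.instance Definition _ := Lmodule_isRieszSpace.Build R (nat -> V)
  seq_le_refl seq_le_anti seq_le_trans seq_leD seq_leZ seq_supP seq_infP.

End SequencesRieszSpace.

Section CompleteLatticeability.
Variables (R : realType) (V : rieszSpaceType R).

Definition riesz_subspace (L : set V) :=
  [/\ L 0, (forall x y, L x -> L y -> L (x + y)),
      (forall (a : R) x, L x -> L (a *: x)),
      (forall x y, L x -> L y -> L (riesz_sup x y)) &
      (forall x y, L x -> L y -> L (riesz_inf x y))].

Definition finite_dimensional (L : set V) :=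
  exists n (b : 'I_n -> V), (forall i, L (b i)) /\
    forall x, L x -> exists c : 'I_n -> R, x = \sum_(i < n) c i *: b i.

Definition norm_closed_in (X : set V) (N : V -> \bar R) (L : set V) :=
  forall x, X x ->
    (forall e : R, 0 < e -> exists2 y, L y & (N (x - y)%R < e%:E)%E) -> L x.

(* The Banach lattice in which [A] is latticeable is the Riesz subspace [X] of
   [V] normed by [N], so its sublattices are the Riesz subspaces of [V]
   included in [X]. *)
Definition completely_latticeable (X : set V) (N : V -> \bar R) (A : set V) :=
  exists L : set V,
    [/\ L `<=` X, riesz_subspace L, norm_closed_in X N L,
        ~ finite_dimensional L & L `\ 0 `<=` A].

End CompleteLatticeability.

Section Orlicz.
Variable R : realType.

(* Only the values of [phi] on [0, +oo) matter. *)
Definition orlicz_function (phi : R -> R) :=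
  [/\ {within `[0, +oo[, continuous phi},
      {in `[0, +oo[ &, {homo phi : s t / s <= t}},
      convex_function (`[0, +oo[ : set R^o) phi,
      phi 0 = 0 & phi t @[t --> +oo] --> +oo].

Definition Delta2 (phi : R -> R) :=
  (forall t, 0 < t -> 0 < phi t) /\
  (limf_esup (fun t : R => (phi (2 * t) / phi t)%:E) 0^'+ < +oo)%E.

Definition admits_complementary (phi : R -> R) :=
  exists p : R -> R,
    [/\ (forall t, 0 <= t -> (phi (t + h) - phi t) / h @[h --> 0^'+] --> p t),
        p 0 = 0 & p t @[t --> +oo] --> +oo].

Definition orlicz_modular (phi : R -> R) (rho : R) (a : R^nat) : \bar R :=
  (\sum_(0 <= j <oo) (phi (`|a j| / rho))%:E)%E.

Definition orlicz_space (phi : R -> R) : set R^nat :=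
  [set a | exists2 rho, 0 < rho & (orlicz_modular phi rho a < +oo)%E].

Definition orlicz_norm (phi : R -> R) (a : R^nat) : \bar R :=
  ereal_inf [set rho%:E | rho in
    [set rho : R | 0 < rho /\ (orlicz_modular phi rho a <= 1)%E]].

End Orlicz.

Section Dual.
Variables (R : realType) (E : banachLatticeType R).

Record dual_space := DualSpace {
  dual_fun :> {linear E -> R^o} ;
  dual_continuous : continuous dual_fun
}.

HB.instance Definition _ := gen_eqMixin dual_space.
HB.instance Definition _ := gen_choiceMixin dual_space.

Definition dual_le (f g : E -> R) := forall x : E, 0 <=r x -> f x <= g x.

Definition is_dual_abs (f g : dual_space) :=
  [/\ dual_le f g, dual_le (\- f) g &
      forall h : dual_space, dual_le f h -> dual_le (\- f) h -> dual_le g h].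

(* The supremum of [f] and [- f] always exists, by the Riesz-Kantorovich
   formula, and is unique, so the default value of [xget] plays no role. *)
Definition dual_abs (f : dual_space) : dual_space := xget f (is_dual_abs f).

End Dual.

Section SequenceSpaces.
Variable R : realType.
Variables (lam : set R^nat) (nlam : R^nat -> \bar R).

Definition kothe_dual : set R^nat :=
  [set b | forall a, lam a -> (\sum_(0 <= j <oo) `|a j * b j|%:E < +oo)%E].

Definition kothe_norm (b : R^nat) : \bar R :=
  ereal_sup [set `| limn (series (fun j => a j * b j)) |%:E | a in
    [set a | lam a /\ (nlam a <= 1)%E]].

Variable E : banachLatticeType R.

Definition weak_dual : set (nat -> dual_space E) :=
  [set xs | forall x : E, kothe_dual (fun j => xs j x)].

Definition strong_space : set (nat -> E) :=
  [set x | forall xs, weak_dual xs ->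
    (\sum_(0 <= j <oo) `|xs j (x j) : R|%:E < +oo)%E].

Definition eps_dual : set (nat -> dual_space E) :=
  [set xs | forall x : E, 0 <=r x ->
    kothe_dual (fun j => dual_abs (xs j) x)].

Definition eps_norm (xs : nat -> dual_space E) : \bar R :=
  ereal_sup [set kothe_norm (fun j => dual_abs (xs j) x) | x in
    [set x : E | 0 <=r x /\ `|x| <= 1]].

Definition positive_eps_dual : set (nat -> dual_space E) :=
  [set xs | eps_dual xs /\ forall j, dual_le (fun=> 0) (xs j)].

Definition pi_space : set (nat -> E) :=
  [set x | forall xs, positive_eps_dual xs ->
    (\sum_(0 <= j <oo) (xs j (riesz_abs (x j)))%:E < +oo)%E].

Definition pi_norm (x : nat -> E) : \bar R :=
  ereal_sup [set (\sum_(0 <= j <oo) (xs j (riesz_abs (x j)))%:E)%E | xs in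
    [set xs | positive_eps_dual xs /\ (eps_norm xs <= 1)%E]].

End SequenceSpaces.

Section OrliczSequenceSpaces.
Variables (R : realType) (phi : R -> R) (E : banachLatticeType R).

Definition orlicz_s : set (nat -> E) := @strong_space R (orlicz_space phi) E.

Definition orlicz_pi : set (nat -> E) := @pi_space R (orlicz_space phi) E.

Definition orlicz_pi_norm (x : nat -> E) : \bar R :=
  pi_norm (orlicz_space phi) (orlicz_norm phi) x.

End OrliczSequenceSpaces.

Arguments orlicz_s {R} phi E.
Arguments orlicz_pi {R} phi E.
Arguments orlicz_pi_norm {R} phi E x.

(* Main.v *)
(** If x is in the pi-space but not in the strong space, so is its positive or
    its negative part, hence we may take x >= 0. Some weakly summable sequence
    of functionals f_j has a divergent sum of the |f_j(x_j)|; partition the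
    indices by k : nat -> nat into infinitely many classes along each of which
    this sum still diverges. The sequences (a_(k j) x_j)_j in the pi-space form
    the required sublattice: it contains the restriction of x to every class,
    and a nonzero member has some a_l <> 0, so that (f_j) makes its sum diverge
    along class l. It is closed because the pi-norm controls the norm of each
    coordinate: unit vectors are bounded in the Orlicz ball, and by Hahn-Banach
    positive functionals of norm at most 1 attain the norm of a positive
    vector. *)
From HB Require Import structures.
Require Import Defs.
From mathcomp Require Import all_boot all_order all_algebra.
From mathcomp Require Import all_classical all_reals all_analysis.
From mathcomp Require Import ring lra.

Set Implicit Arguments.
Unset Strict Implicit.
Unset Printing Implicit Defensive.

Import Order.TTheory GRing.Theory Num.Theory.
Import numFieldNormedType.Exports.

Local Open Scope classical_set_scope.
Local Open Scope ring_scope.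

(** * Lattice arithmetic in Riesz spaces *)

Section RieszSpaceTheory.
Variables (R : realType) (V : rieszSpaceType R).
Implicit Types (x y z : V) (a b : R).

Lemma riesz_le_supl x y : x <=r riesz_sup x y.
Proof. by have /riesz_supP[] := riesz_le_refl (riesz_sup x y). Qed.

Lemma riesz_le_supr x y : y <=r riesz_sup x y.
Proof. by have /riesz_supP[] := riesz_le_refl (riesz_sup x y). Qed.

Lemma riesz_leDD x y z t : x <=r y -> z <=r t -> x + z <=r y + t.
Proof.
move=> xy zt; apply: riesz_le_trans (riesz_leD _ _ z xy) _.
by rewrite ![y + _]addrC; exact: riesz_leD.
Qed.

Lemma riesz_subr_ge0 x y : 0 <=r y - x <-> x <=r y.
Proof.
split=> [/(riesz_leD _ _ x)|/(riesz_leD _ _ (- x))]; first by rewrite add0r subrK.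
by rewrite subrr.
Qed.

Lemma riesz_leN x y : x <=r y -> - y <=r - x.
Proof. by move=> /riesz_subr_ge0 xy; apply/riesz_subr_ge0; rewrite opprK addrC. Qed.

Lemma riesz_supC x y : riesz_sup x y = riesz_sup y x.
Proof.
by apply: riesz_le_anti; apply/riesz_supP; split;
  by [exact: riesz_le_supl | exact: riesz_le_supr].
Qed.

Lemma riesz_sup_r x y : x <=r y -> riesz_sup x y = y.
Proof.
move=> xy; apply: riesz_le_anti; last exact: riesz_le_supr.
by apply/riesz_supP; split=> //; exact: riesz_le_refl.
Qed.

Lemma riesz_inf_l x y : x <=r y -> riesz_inf x y = x.
Proof.
move=> xy; apply: riesz_le_anti; last first.
  by apply/riesz_infP; split=> //; exact: riesz_le_refl.
by have /riesz_infP[] := riesz_le_refl (riesz_inf x y).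
Qed.

Lemma riesz_infC x y : riesz_inf x y = riesz_inf y x.
Proof.
have infl (s t : V) : riesz_inf s t <=r s /\ riesz_inf s t <=r t.
  by apply/riesz_infP; exact: riesz_le_refl.
by apply: riesz_le_anti; apply/riesz_infP; have [] := infl x y;
  have [] := infl y x.
Qed.

Lemma riesz_supDr x y z : riesz_sup x y + z = riesz_sup (x + z) (y + z).
Proof.
apply: riesz_le_anti; last first.
  by apply/riesz_supP; split; apply: riesz_leD;
    [exact: riesz_le_supl | exact: riesz_le_supr].
(* Moving [z] across, it suffices to bound [x] and [y] by the right side minus [z]. *)
apply/riesz_subr_ge0; rewrite opprD addrCA addrC; apply/riesz_subr_ge0.
by apply/riesz_supP; split; apply/riesz_subr_ge0; rewrite addrAC -addrA -opprD;
  apply/riesz_subr_ge0; [exact: riesz_le_supl | exact: riesz_le_supr].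
Qed.

(** One inequality holds for every nonnegative scalar; for [0 < a], applying it to [a^-1] gives the
    other. *)
Lemma riesz_supZ a x y : 0 <= a ->
  riesz_sup (a *: x) (a *: y) = a *: riesz_sup x y.
Proof.
have le b (s t : V) : 0 <= b -> riesz_sup (b *: s) (b *: t) <=r b *: riesz_sup s t.
  by move=> b0; apply/riesz_supP; split; apply: riesz_leZ => //;
    [exact: riesz_le_supl | exact: riesz_le_supr].
rewrite le_eqVlt => /predU1P[<-|a0].
  by rewrite !scale0r riesz_sup_r//; exact: riesz_le_refl.
apply: riesz_le_anti; first exact/le/ltW.
rewrite -[X in _ <=r X](scalerKV (lt0r_neq0 a0)).
apply: riesz_leZ (ltW a0) _.
have := le a^-1 (a *: x) (a *: y).
by rewrite !(scalerK (lt0r_neq0 a0))// invr_ge0 => /(_ (ltW a0)).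
Qed.

Lemma riesz_le_scale a b x : 0 <=r x -> a <= b -> a *: x <=r b *: x.
Proof.
move=> x0 ab; apply/riesz_subr_ge0; rewrite -scalerBl -[0](scaler0 _ (b - a)).
by apply: riesz_leZ => //; rewrite subr_ge0.
Qed.

(** The multiples of one positive vector form a chain, ordered as their coefficients. This will make
    the classwise multiples a sublattice. *)
Lemma riesz_sup_scale a b x : 0 <=r x ->
  riesz_sup (a *: x) (b *: x) = Num.max a b *: x.
Proof.
move=> x0; have [ab|/ltW ba] := leP a b.
  exact/riesz_sup_r/riesz_le_scale.
by rewrite riesz_supC; exact/riesz_sup_r/riesz_le_scale.
Qed.

Lemma riesz_inf_scale a b x : 0 <=r x ->
  riesz_inf (a *: x) (b *: x) = Num.min a b *: x.
Proof.
move=> x0; have [ab|/ltW ba] := leP a b.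
  exact/riesz_inf_l/riesz_le_scale.
by rewrite riesz_infC; exact/riesz_inf_l/riesz_le_scale.
Qed.

Lemma riesz_abs_scale a x : 0 <=r x -> riesz_abs (a *: x) = `|a| *: x.
Proof.
move=> x0; rewrite /riesz_abs -scaleNr riesz_sup_scale//; congr (_ *: _).
have [a0|/ltW a0] := leP 0 a.
  by rewrite ger0_norm//; apply/max_idPl; lra.
by rewrite ler0_norm//; apply/max_idPr; lra.
Qed.

Lemma riesz_absid x : 0 <=r x -> riesz_abs x = x.
Proof. by move=> /(riesz_abs_scale 1); rewrite scale1r normr1 scale1r. Qed.

(** Both [x] and [- x] lie below the modulus, so their sum 0 lies below twice the modulus. *)
Lemma riesz_abs_ge0 x : 0 <=r riesz_abs x.
Proof.
have := riesz_leDD (riesz_le_supl x (- x)) (riesz_le_supr x (- x)).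
rewrite subrr -/(riesz_abs x) -mulr2n -scaler_nat => /(riesz_leZ 2^-1 _ _).
by rewrite scalerA mulVf// scale1r scaler0 invr_ge0 ler0n; exact.
Qed.

Definition riesz_pos x : V := riesz_sup x 0.

Lemma riesz_pos_ge0 x : 0 <=r riesz_pos x.
Proof. exact: riesz_le_supr. Qed.

Lemma riesz_pos_le_abs x : riesz_pos x <=r riesz_abs x.
Proof.
by apply/riesz_supP; split; [exact: riesz_le_supl | exact: riesz_abs_ge0].
Qed.

(** Translating [riesz_sup (- x) 0] by [x] gives [riesz_sup 0 x]. *)
Lemma riesz_pos_sub x : x = riesz_pos x - riesz_pos (- x).
Proof.
apply/eqP; rewrite eq_sym subr_eq addrC; apply/eqP.
by rewrite /riesz_pos riesz_supDr addNr add0r riesz_supC.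
Qed.

Lemma riesz_posid x : 0 <=r x -> riesz_pos x = x.
Proof. by move=> x0; rewrite /riesz_pos riesz_supC riesz_sup_r. Qed.

Lemma riesz_posZ a x : 0 <= a -> riesz_pos (a *: x) = a *: riesz_pos x.
Proof. by move=> a0; rewrite /riesz_pos -{1}[0](scaler0 _ a) riesz_supZ. Qed.

Lemma riesz_posD x y : riesz_pos (x + y) <=r riesz_pos x + riesz_pos y.
Proof.
apply/riesz_supP; split; first by apply: riesz_leDD; exact: riesz_le_supl.
by rewrite -[0]addr0; apply: riesz_leDD; exact: riesz_le_supr.
Qed.

End RieszSpaceTheory.

(** * Monotonicity of the lattice norm *)

Section BanachLatticeTheory.
Variables (R : realType) (E : banachLatticeType R).
Implicit Types x y : E.

Lemma norm_riesz_le x y : 0 <=r x -> x <=r y -> `|x| <= `|y|.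
Proof.
move=> x0 xy; apply: banach_lattice_norm.
by rewrite !riesz_absid//; exact: riesz_le_trans xy.
Qed.

Lemma norm_riesz_abs x : `|riesz_abs x| = `|x|.
Proof.
have abs_abs : riesz_abs (riesz_abs x) = riesz_abs x.
  exact/riesz_absid/riesz_abs_ge0.
by apply/eqP; rewrite eq_le; apply/andP; split; apply: banach_lattice_norm;
  rewrite abs_abs; exact: riesz_le_refl.
Qed.

Lemma norm_riesz_pos_le x : `|riesz_pos x| <= `|x|.
Proof.
rewrite -(norm_riesz_abs x); apply: norm_riesz_le; first exact: riesz_pos_ge0.
exact: riesz_pos_le_abs.
Qed.

End BanachLatticeTheory.

(** * Nonnegative series and the splitting of a divergent one *)

Lemma nneseries_ltyP (R : realType) (u : nat -> R) : (forall j, 0 <= u j) ->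
  (\sum_(0 <= j <oo) (u j)%:E < +oo)%E <->
  exists M, forall n, \sum_(0 <= j < n) u j <= M.
Proof.
move=> u0; have uE0 j : (0 <= (u j)%:E)%E by rewrite lee_fin.
split=> [|[M uM]].
  move=> fin; exists (fine (\sum_(0 <= j <oo) (u j)%:E)%E) => n.
  rewrite -lee_fin fineK; last first.
    by rewrite ge0_fin_numE//; apply: nneseries_ge0 => j _ _; exact: uE0.
  by rewrite -sumEFin; apply: nneseries_lim_ge => j _ _; exact: uE0.
apply: (@le_lt_trans _ _ M%:E); last exact: ltry.
apply: lime_le; first by apply: is_cvg_nneseries => j _ _; exact: uE0.
by apply: nearW => n; rewrite sumEFin lee_fin.
Qed.

(* The blocks [n_i, n_(i+1)) are cut so that each carries mass at least 1; the
   2-adic valuation of i + 1 takes every value infinitely often. *)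
Lemma divergent_partition (R : realType) (u : nat -> R) :
  (forall j, 0 <= u j) ->
  (forall M, exists n, M < \sum_(0 <= j < n) u j) ->
  exists k : nat -> nat, forall l M,
    exists n, M < \sum_(0 <= j < n | k j == l) u j.
Proof.
move=> u0 udiv.
have mono (P : pred nat) a b : (a <= b)%N ->
    \sum_(0 <= j < a | P j) u j <= \sum_(0 <= j < b | P j) u j.
  move=> ab; rewrite (big_cat_nat (leq0n a) ab)//= lerDl.
  by apply: sumr_ge0 => j _; exact: u0.
(* The partial sums are unbounded, so some of them exceed the part below [N] by at least 1. *)
have /choice[g g1] N : exists m, 1 <= \sum_(N <= j < m) u j.
  have [m hm] := udiv (1 + \sum_(0 <= j < N) u j).
  exists m; have [Nm|/ltnW mN] := leqP N m.
    by move: hm; rewrite (big_cat_nat (leq0n N) Nm)//=; lra.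
  have := mono xpredT _ _ mN.
  by lra.
have gN N : (N < g N)%N.
  by rewrite ltnNge; apply/negP => gN; have := g1 N; rewrite big_geq//; lra.
pose n i := iter i g 0%N.
have nmono : {homo n : i j / (i <= j)%N}.
  by apply: homo_leq => // [|i]; [exact: leq_trans | exact/ltnW/gN].
have ni i : (i <= n i)%N by elim: i => // i ih; exact: leq_ltn_trans (gN _).
have /choice[b bP] j : exists i, (n i <= j < n i.+1)%N.
  elim: j => [|j [i /andP[ij ji]]]; first by exists 0%N; rewrite /= gN.
  have [jn|nj] := ltnP j.+1 (n i.+1).
    by exists i; rewrite jn andbT; exact: leqW.
  exists i.+1; have -> : j.+1 = n i.+1 by apply/eqP; rewrite eqn_leq nj ji.
  by rewrite leqnn; exact: gN.
have bE i j : (n i <= j < n i.+1)%N -> b j = i.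
  move=> /andP[ij ji]; have /andP[bj jb] := bP j; apply/eqP.
  rewrite eqn_leq (leqNgt (b j)) (leqNgt i); apply/andP; split; apply/negP => /nmono.
    by move=> /leq_trans/(_ bj); rewrite leqNgt ji.
  by move=> /leq_trans/(_ ij); rewrite leqNgt jb.
exists (fun j => logn 2 (b j).+1) => l.
pose S m := \sum_(0 <= j < m | logn 2 (b j).+1 == l) u j.
have step N : exists m, 1 + S N <= S m.
  (* [i.+1] is [2 ^ l] times an odd number, so block [i] belongs to class [l]; the odd factor also
     forces [N <= i], so the block starts at [N] or later. *)
  pose i := (2 ^ l * N.*2.+1).-1.
  have i1 : i.+1 = (2 ^ l * N.*2.+1)%N by rewrite prednK// muln_gt0 expn_gt0.
  have vi : logn 2 i.+1 = l.
    rewrite i1 lognM ?expn_gt0// pfactorK//.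
    by rewrite [X in (_ + X)%N]logn_coprime ?addn0// coprime2n /= odd_double.
  have Ni : (N <= i)%N.
    rewrite -ltnS i1; apply: leq_trans (leq_pmull _ _); last by rewrite expn_gt0.
    by rewrite ltnS -addnn leq_addr.
  exists (n i.+1); have nn : (n i <= n i.+1)%N by exact/nmono/leqnSn.
  rewrite /S (big_cat_nat (leq0n _) nn)//= addrC lerD//; last first.
    by apply: mono; exact: leq_trans Ni (ni i).
  apply: (le_trans (g1 (n i))); rewrite le_eqVlt; apply/orP; left; apply/eqP.
  by apply: congr_big_nat => // j /(bE i) ->; rewrite vi eqxx.
have big (m : nat) : exists N, m%:R <= S N.
  elim: m => [|m [N mN]]; first by exists 0%N; rewrite /S big_geq.
  have [N' N'm] := step N; exists N'; apply: le_trans N'm.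
  by rewrite -natr1 addrC lerD2l.
move=> M; have [N hN] := big (Num.truncn M).+1; exists N.
exact: lt_le_trans (truncnS_gt M) hN.
Qed.

(** * The Hahn-Banach theorem for a sublinear functional *)

Section HahnBanach.
Variables (R : realType) (V : lmodType R) (p : V -> R).
Hypothesis p_subadd : forall x y, p (x + y) <= p x + p y.
Hypothesis p_homog : forall a x, 0 <= a -> p (a *: x) = a * p x.

(* A graph of a linear functional on a subspace; it is automatically
   single-valued, since (0, r) in [G] forces r <= 0 and - r <= 0. *)
Let dominated (G : set (V * R)) :=
  (forall a x y r s, G (x, r) -> G (y, s) -> G (a *: x + y, a * r + s)) /\
  (forall x r, G (x, r) -> r <= p x).

Let p0 : p 0 = 0.
Proof. by rewrite -(scale0r 0) p_homog// mul0r. Qed.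

Let dominated_fun G x r s : dominated G -> G (x, r) -> G (x, s) -> r = s.
Proof.
move=> [lin dom] xr xs; apply/eqP; rewrite eq_le.
have le0 t : G (0, t) -> t <= 0 by move=> /dom; rewrite p0.
have := lin (-1) _ _ _ _ xr xs; have := lin (-1) _ _ _ _ xs xr.
by rewrite !scaleN1r !addNr !mulN1r => /le0 ? /le0 ?; apply/andP; split; lra.
Qed.

(** For negative [a] the bound follows from [0 = p 0 <= p (a *: u) + p (- a *: u)], whose last term
    is [- a * p u]. *)
Let dominated_line u :
  dominated [set z | exists a, z = (a *: u, a * p u)].
Proof.
split=> [a _ _ _ _ [b [-> ->]] [c [-> ->]]|_ _ [a [-> ->]]].
  by exists (a * b + c); rewrite scalerA -scalerDl mulrA -mulrDl.
have [a0|/ltW a0] := leP 0 a; first by rewrite p_homog.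
rewrite -subr_ge0; have := p_subadd (a *: u) (- a *: u).
by rewrite -scalerDl subrr scale0r p0 [p (- a *: u)]p_homog; lra.
Qed.

(** The value [c] at [v] must lie above every [r - p (x - v)] and below every [p (x + v) - r].
    Subadditivity puts each lower bound below each upper bound, so the supremum of the lower bounds
    works. *)
Let dominated_ext G v : dominated G -> G !=set0 ->
  exists c, dominated [set z | exists x r t,
    G (x, r) /\ z = (x + t *: v, r + t * c)].
Proof.
move=> [lin dom] [[x0 r0] G0].
have G00 : G (0, 0).
  by have := lin (-1) _ _ _ _ G0 G0; rewrite scaleN1r mulN1r !addNr.
have scale a x r : G (x, r) -> G (a *: x, a * r).
  by move=> xr; have := lin a _ _ _ _ xr G00; rewrite !addr0.
pose S := [set z : R | exists x r, G (x, r) /\ z = r - p (x - v)].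
have Sub x r : G (x, r) -> ubound S (p (x + v) - r).
  move=> xr _ [y [s [ys ->]]].
  have /dom := lin 1 _ _ _ _ xr ys; rewrite scale1r mul1r.
  have := p_subadd (x + v) (y - v).
  by rewrite addrACA subrr addr0; lra.
have S0 : S !=set0 by exists (r0 - p (x0 - v)), x0, r0.
have le_up x r : G (x, r) -> r + sup S <= p (x + v).
  by move=> /Sub /(ge_sup S0); lra.
have le_dn x r : G (x, r) -> r - sup S <= p (x - v).
  move=> xr; have : r - p (x - v) <= sup S; last lra.
  by apply: ub_le_sup; [exists (p (x0 + v) - r0); exact: Sub | exists x, r].
exists (sup S); split=> [a _ _ _ _ [x [r [t [xr [-> ->]]]]]
    [y [s [q [ys [-> ->]]]]]|].
  exists (a *: x + y), (a * r + s), (a * t + q).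
  split; first exact: lin.
  by congr pair; [rewrite scalerDr scalerDl scalerA addrACA | ring].
(* Homogeneity reduces a nonzero [t] to 1 or -1 after division by its absolute value. *)
move=> _ _ [x [r [t [xr [-> ->]]]]]; have [t0|t0|->] := ltgtP t 0; last first.
- by rewrite scale0r mul0r !addr0; exact: dom.
- have := le_up _ _ (scale t^-1 _ _ xr).
  rewrite -(ler_pM2l t0) -p_homog ?(ltW t0)// scalerDr mulrDr mulrA.
  by rewrite scalerA divff ?gt_eqF// mul1r scale1r.
- have nt0 : 0 < - t by rewrite oppr_gt0.
  have := le_dn _ _ (scale (- t)^-1 _ _ xr).
  rewrite -(ler_pM2l nt0) -p_homog ?(ltW nt0)// scalerBr mulrBr mulrA.
  by rewrite scalerA divff ?gt_eqF// mul1r scale1r scaleNr mulNr !opprK.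
Qed.

Lemma Hahn_Banach (u : V) : exists f : {linear V -> R^o},
  (forall x, f x <= p x) /\ f u = p u.
Proof.
pose P (G : set (V * R)) := dominated G /\ (G !=set0 -> G (u, p u)).
have [F FP Ftot|G [[Gdom Gu] Gmax]] := @Zorn_bigcup _ P.
  split; last by move=> [z [G FG Gz]]; exists G => //; apply: (FP G FG).2; exists z.
  split=> [a x y r s [G FG xr] [H FH ys]|x r [G FG xr]].
    have [GH|HG] := Ftot _ _ FG FH.
      by exists H => //; apply: (FP H FH).1.1 => //; exact: GH.
    by exists G => //; apply: (FP G FG).1.1 => //; exact: HG.
  exact: (FP G FG).1.2 xr.
(* An empty maximal graph would be properly contained in the line through [(u, p u)]. *)
have G0 : G !=set0.
  apply/set0P/eqP => G0; pose L := [set z | exists a, z = (a *: u, a * p u)].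
  have Lu : L (u, p u) by exists 1; rewrite scale1r mul1r.
  apply: (Gmax L); last by split => //; exact: dominated_line.
  by rewrite G0; split=> // /(_ _ Lu).
have {}Gu := Gu G0.
(* At a point outside the domain, the one-step extension would contradict maximality. *)
have Gtot x : exists r, G (x, r).
  apply: contrapT => Gx; have [c Hd] := dominated_ext x Gdom G0.
  have sub z : G z -> exists y r t, G (y, r) /\ z = (y + t *: x, r + t * c).
    by case: z => y r yr; exists y, r, 0; rewrite scale0r mul0r !addr0.
  apply: Gmax (conj Hd (fun _ => sub _ Gu)); split=> // H.
  apply: Gx; exists c; apply: H; exists 0, 0, 1.
  rewrite !add0r scale1r mul1r; split=> //.
  by have := Gdom.1 (-1) _ _ _ _ Gu Gu; rewrite scaleN1r mulN1r !addNr.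
have /choice[f Gf] := Gtot.
have flin : linear (f : V -> R^o).
  by move=> a x y; apply: (dominated_fun Gdom (Gf _)); exact: Gdom.1.
pose fl : {linear V -> R^o} := HB.pack (f : V -> R^o)
  (GRing.isLinear.Build R V R^o _ f flin).
exists fl; split=> [x|]; first exact: Gdom.2 (Gf x).
exact: dominated_fun Gdom (Gf u) Gu.
Qed.

End HahnBanach.

(** * Positive continuous functionals *)

Section PositiveFunctionals.
Variables (R : realType) (E : banachLatticeType R).
Implicit Types (f : dual_space E) (x y : E).

Lemma dual_space_of_bounded (g : E -> R) : linear (g : E -> R^o) ->
  (exists M, forall x, `|g x| <= M * `|x|) ->
  exists f, forall x, f x = g x.
Proof.
move=> glin [M gM].
pose fl : {linear E -> R^o} := HB.pack (g : E -> R^o)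
  (GRing.isLinear.Build R E R^o _ g glin).
have flc : continuous fl.
  apply/linear_bounded_continuous/linear_boundedP.
  apply: filterS (nbhs_pinfty_ge (num_real M)) => r Mr x.
  by apply: le_trans (gM x) _; exact: ler_wpM2r.
by exists (DualSpace flc).
Qed.

Lemma dual_fun_le f x y : dual_le (fun=> 0) f -> x <=r y -> f x <= f y.
Proof. by move=> f0 /riesz_subr_ge0 /f0; rewrite linearB subr_ge0. Qed.

(** A positive [f] meets the conditions defining its own modulus, and minimality makes any two such
    functionals agree on the positive cone. *)
Lemma dual_abs_pos f x : dual_le (fun=> 0) f -> 0 <=r x -> dual_abs f x = f x.
Proof.
move=> f0 x0; have fabs : is_dual_abs f f.
  by split=> // y /f0 fy /=; lra.
have [le_f _ min_f] := xgetI f fabs.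
apply/eqP; rewrite eq_le; apply/andP; split; last exact: le_f.
by apply: min_f => //; have [] := fabs.
Qed.

(* Hahn-Banach for the sublinear functional [x |-> `|x^+|], which vanishes on
   negative vectors and so dominates only positive functionals. *)
Lemma positive_norming (u : E) : 0 <=r u -> exists f,
  [/\ dual_le (fun=> 0) f, forall x, `|f x| <= `|x| & f u = `|u|].
Proof.
move=> u0; pose p x := `|riesz_pos x|.
have pD x y : p (x + y) <= p x + p y.
  apply: le_trans (ler_normD _ _).
  by apply: norm_riesz_le; [exact: riesz_pos_ge0 | exact: riesz_posD].
have pZ a x : 0 <= a -> p (a *: x) = a * p x.
  by move=> a0; rewrite /p riesz_posZ// normrZ ger0_norm.
have [g [gp gu]] := Hahn_Banach pD pZ u.
have g1 x : `|g x| <= `|x|.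
  rewrite ler_norml lerNl; apply/andP; split; last first.
    exact: le_trans (gp x) (norm_riesz_pos_le x).
  rewrite -linearN -[leRHS]normrN.
  exact: le_trans (gp (- x)) (norm_riesz_pos_le (- x)).
have [|f fE] := @dual_space_of_bounded g (@linearP _ _ _ _ g).
  by exists 1 => x; rewrite mul1r.
exists f; split=> [x x0|x|]; rewrite fE//.
  have := gp (- x); rewrite linearN /p /riesz_pos riesz_sup_r.
    by rewrite normr0 oppr_le0.
  by rewrite -[X in _ <=r X]oppr0; exact: riesz_leN.
by rewrite gu /p riesz_posid.
Qed.

End PositiveFunctionals.

(** * Membership in the pi-space and the strong space, and the pi-norm *)

Section PiSpace.
Variables (R : realType) (lam : set R^nat) (E : banachLatticeType R).
Implicit Types (x y z : nat -> E) (c : R).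

Lemma pi_spaceP z : pi_space lam z <->
  forall xs : nat -> dual_space E, positive_eps_dual lam xs ->
    exists M, forall n, \sum_(0 <= j < n) xs j (riesz_abs (z j)) <= M.
Proof.
have xs0 (xs : nat -> dual_space E) j : positive_eps_dual lam xs ->
    0 <= xs j (riesz_abs (z j)).
  by move=> [_ ->//]; exact: riesz_abs_ge0.
by split=> zpi xs xsd; have /nneseries_ltyP := xs0 xs ^~ xsd;
  move=> fin; apply/fin/zpi.
Qed.

(** Positive functionals are monotone. This single criterion serves sums, scalar multiples, suprema
    and infima alike. *)
Lemma pi_space_dominated c x y z : 0 <= c -> pi_space lam x -> pi_space lam y ->
  (forall j, riesz_abs (z j) <=r c *: (riesz_abs (x j) + riesz_abs (y j))) ->
  pi_space lam z.
Proof.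
move=> c0 /pi_spaceP xpi /pi_spaceP ypi zle; apply/pi_spaceP => xs xsd.
have [[M xM] [N yN]] := (xpi xs xsd, ypi xs xsd).
exists (c * (M + N)) => n.
apply: (@le_trans _ _ (\sum_(0 <= j < n)
    c * (xs j (riesz_abs (x j)) + xs j (riesz_abs (y j))))).
  apply: ler_sum => j _; have := dual_fun_le (xsd.2 j) (zle j).
  by rewrite linearZ linearD.
by rewrite -mulr_sumr ler_wpM2l// big_split lerD.
Qed.

Lemma strong_spaceP z : strong_space lam z <->
  forall xs : nat -> dual_space E, weak_dual lam xs ->
    exists M, forall n, \sum_(0 <= j < n) `|xs j (z j) : R| <= M.
Proof.
by split=> zs xs xsd; have /nneseries_ltyP fin j : 0 <= `|xs j (z j) : R| by [];
  apply/fin/zs.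
Qed.

Lemma strong_spaceB x y : strong_space lam x -> strong_space lam y ->
  strong_space lam (fun j => x j - y j).
Proof.
move=> /strong_spaceP xs /strong_spaceP ys; apply/strong_spaceP => f fd.
have [[M xM] [N yN]] := (xs f fd, ys f fd); exists (M + N) => n.
apply: le_trans (lerD (xM n) (yN n)); rewrite -big_split.
by apply: ler_sum => j _; rewrite linearB; exact: ler_normB.
Qed.

End PiSpace.

(** The pi-norm is tested on the sequence whose only nonzero entry, at [j], is [C^-1] times a
    positive functional norming the modulus of [w j]. The coordinate bound [C] keeps its eps-norm at
    most 1. *)
Lemma norm_coord_le_pi_norm (R : realType) (lam : set R^nat)
    (nlam : R^nat -> \bar R) (C : R) (E : banachLatticeType R) (w : nat -> E) j :
  0 < C -> (forall a, lam a -> (nlam a <= 1)%E -> `|a j| <= C) ->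
  ((`|w j| / C)%:E <= pi_norm lam nlam w)%E.
Proof.
move=> C0 lamC.
have [f [f0 f1 fw]] := positive_norming (riesz_abs_ge0 (w j)).
have [||g gE] := @dual_space_of_bounded _ E (fun x => C^-1 * f x).
- by move=> a x y; rewrite linearP mulrDr /GRing.scale /=; ring.
- exists C^-1 => x; rewrite normrM gtr0_norm ?invr_gt0//.
  by rewrite ler_pM2l ?invr_gt0.
have [||d dE] := @dual_space_of_bounded _ E (fun=> 0).
- by move=> a x y; rewrite scaler0 addr0.
- by exists 0 => x; rewrite normr0 mul0r.
pose xs i := if i == j then g else d.
have xsE i x : xs i x = if i == j then C^-1 * f x else 0.
  by rewrite /xs; case: ifP.
have xs0 i : dual_le (fun=> 0) (xs i).
  move=> x x0; rewrite xsE; case: ifP => // _.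
  by apply: mulr_ge0; [rewrite invr_ge0 ltW | exact: f0].
have absE x : 0 <=r x ->
    (fun i => dual_abs (xs i) x) = (fun i => if i == j then C^-1 * f x else 0).
  by move=> x0; apply/funext => i; rewrite dual_abs_pos.
(* Used with the absolute value as [h] for membership in the Köthe dual, and with the identity for
   the Köthe norm. *)
have sumE (h : R -> R) (a : R^nat) (v : R) n : h 0 = 0 ->
    \sum_(0 <= i < n) h (a i * (if i == j then v else 0)) =
    if (j < n)%N then h (a j * v) else 0.
  move=> h0; rewrite (eq_bigr (fun i => if i == j then h (a i * v) else 0)).
    by rewrite -big_mkcond big_nat1_eq.
  by move=> i _; case: ifP => // _; rewrite mulr0.
apply: (@le_trans _ _ (\sum_(0 <= i <oo) (xs i (riesz_abs (w i)))%:E)%E).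
  apply: (le_trans _ (nneseries_lim_ge j.+1 _)); last first.
    by move=> i _ _; rewrite lee_fin xs0//; exact: riesz_abs_ge0.
  rewrite sumEFin lee_fin big_nat_recr//= xsE eqxx fw norm_riesz_abs mulrC.
  by rewrite lerDr; apply: sumr_ge0 => i _; apply: xs0; exact: riesz_abs_ge0.
apply: ereal_sup_ubound; exists xs => //; split; first split=> //.
  move=> x x0; rewrite absE// => a lama; apply/nneseries_ltyP => //.
  exists `|a j * (C^-1 * f x)| => n.
  by rewrite (sumE (fun t => `|t|)) ?normr0//; case: ifP.
apply: ge_ereal_sup => _ [x [x0 x1] <-]; rewrite absE//.
apply: ge_ereal_sup => _ [a [lama a1] <-].
(* The partial sums are constant past [j], so the limit is the single term at [j]. *)
rewrite lee_fin (@lim_near_cst _ _ _ _ _ (a j * (C^-1 * f x))).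
- rewrite normrM -[leRHS](divff (lt0r_neq0 C0)).
  apply: ler_pM => //; first exact: lamC.
  rewrite normrM gtr0_norm ?invr_gt0// -[leRHS]mulr1.
  by rewrite ler_pM2l ?invr_gt0//; exact: le_trans (f1 x) x1.
- exact: norm_hausdorff.
- near=> n; rewrite /series /= (sumE id)//.
  suff -> : (j < n)%N by [].
  by near: n; exact: nbhs_infty_gt.
Unshelve. all: by end_near. Qed.

(** * The dichotomy over a general scalar sequence space *)

Section PiMinusStrong.
Variables (R : realType) (lam : set R^nat) (E : banachLatticeType R).
Implicit Types x z : nat -> E.

(** Both parts of [x] stay in the pi-space by domination, and they cannot both be in the strong
    space, which is closed under differences. *)
Lemma ge0_pi_minus_strong x : pi_space lam x -> ~ strong_space lam x ->
  exists y : nat -> E,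
    [/\ forall j, 0 <=r y j, pi_space lam y & ~ strong_space lam y].
Proof.
move=> xpi xs; have abs_pi z : (forall j, riesz_abs (z j) <=r riesz_abs (x j)) ->
    pi_space lam z.
  move=> zx; apply: (@pi_space_dominated _ _ _ 1 x x) => // j.
  rewrite scale1r; apply: riesz_le_trans (zx j) _.
  rewrite -[X in X <=r _]addr0; apply: riesz_leDD; first exact: riesz_le_refl.
  exact: riesz_abs_ge0.
have [sp|nsp] := pselect (strong_space lam (fun j => riesz_pos (x j))); last first.
  exists (fun j => riesz_pos (x j)); split=> // [j|]; first exact: riesz_pos_ge0.
  apply: abs_pi => j; rewrite riesz_absid; last exact: riesz_pos_ge0.
  exact: riesz_pos_le_abs.
exists (fun j => riesz_pos (- x j)); split=> [j||sn].
- exact: riesz_pos_ge0.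
- apply: abs_pi => j; rewrite riesz_absid; last exact: riesz_pos_ge0.
  apply: riesz_le_trans (riesz_pos_le_abs _) _.
  by rewrite /riesz_abs opprK riesz_supC; exact: riesz_le_refl.
apply: xs; rewrite (_ : x = fun j => riesz_pos (x j) - riesz_pos (- x j)).
  exact: strong_spaceB.
by apply/funext => j; exact: riesz_pos_sub.
Qed.

(** * The closed sublattice of multiples of [x] along classes *)

Section ClasswiseMultiples.
Variables (x : nat -> E) (k : nat -> nat).
Hypotheses (x_ge0 : forall j, 0 <=r x j) (x_pi : pi_space lam x).

(** The coefficients may be unbounded: only membership in the pi-space restricts them, so that norm
    limits taken in that space remain in the set. *)
Definition classwise_multiples : set (nat -> E) :=
  [set z | pi_space lam z /\ exists a, forall j, z j = a (k j) *: x j].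

Lemma classwise_multiples_sub : classwise_multiples `<=` @pi_space R lam E.
Proof. by move=> z []. Qed.

(** Reduces the sublattice operations to scalar inequalities between coefficients. *)
Let pi_classwise c (a b d : nat -> R) : 0 <= c ->
  pi_space lam (fun j => a (k j) *: x j) ->
  pi_space lam (fun j => b (k j) *: x j) ->
  (forall l, `|d l| <= c * (`|a l| + `|b l|)) ->
  pi_space lam (fun j => d (k j) *: x j).
Proof.
move=> c0 api bpi dab; apply: pi_space_dominated c0 api bpi _ => j.
rewrite !riesz_abs_scale// -scalerDl scalerA.
exact: riesz_le_scale.
Qed.

(** Supplies the zero sequence and the restrictions of [x] to single classes. *)
Lemma classwise_multiples_bounded (a : nat -> R) :
  (forall l, `|a l| <= 1) -> classwise_multiples (fun j => a (k j) *: x j).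
Proof.
move=> a1; split; last by exists a.
have x1 : pi_space lam (fun j => cst 1 (k j) *: x j).
  by rewrite (_ : (fun j => _) = x)//; apply/funext => j; rewrite scale1r.
by apply: (pi_classwise ler01 x1 x1) => l; have := a1 l; rewrite normr1; lra.
Qed.

Lemma riesz_subspace_classwise_multiples : riesz_subspace classwise_multiples.
Proof.
have elt z : classwise_multiples z -> exists a,
    pi_space lam (fun j => a (k j) *: x j) /\ z = (fun j => a (k j) *: x j).
  by move=> [zpi [a za]]; exists a; have <- : z = _ := funext za.
split.
- have := @classwise_multiples_bounded (fun=> 0).
  rewrite (_ : (fun j => _) = 0); last by apply/funext => j; rewrite scale0r.
  by apply=> _; rewrite normr0.
- move=> _ _ /elt[a [api ->]] /elt[b [bpi ->]]; split.
    rewrite (_ : _ + _ = fun j => (a \+ b) (k j) *: x j).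
      by apply: (pi_classwise ler01 api bpi) => l; rewrite mul1r ler_normD.
    by apply/funext => j; rewrite scalerDl.
  by exists (a \+ b) => j; rewrite scalerDl.
- move=> c _ /elt[a [api ->]]; split.
    rewrite (_ : _ *: _ = fun j => (c \*o a) (k j) *: x j).
      apply: (pi_classwise (normr_ge0 c) api api) => l /=; rewrite normrM.
      by rewrite ler_wpM2l// lerDl.
    by apply/funext => j; rewrite /= -scalerA.
  by exists (c \*o a) => j; rewrite /= -scalerA.
- move=> _ _ /elt[a [api ->]] /elt[b [bpi ->]].
  pose d l := Num.max (a l) (b l).
  have dE j : riesz_sup (a (k j) *: x j) (b (k j) *: x j) = d (k j) *: x j.
    exact: riesz_sup_scale.
  split; last by exists d.
  have -> : riesz_sup (fun j => a (k j) *: x j) (fun j => b (k j) *: x j) =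
      (fun j => d (k j) *: x j) by apply/funext => j; exact: dE.
  apply: (pi_classwise ler01 api bpi) => l; rewrite mul1r /d.
  by case: (leP (a l)) => _; rewrite ?lerDl ?lerDr.
- move=> _ _ /elt[a [api ->]] /elt[b [bpi ->]].
  pose d l := Num.min (a l) (b l).
  have dE j : riesz_inf (a (k j) *: x j) (b (k j) *: x j) = d (k j) *: x j.
    exact: riesz_inf_scale.
  split; last by exists d.
  have -> : riesz_inf (fun j => a (k j) *: x j) (fun j => b (k j) *: x j) =
      (fun j => d (k j) *: x j) by apply/funext => j; exact: dE.
  apply: (pi_classwise ler01 api bpi) => l; rewrite mul1r /d.
  by case: (leP (a l)) => _; rewrite ?lerDl ?lerDr.
Qed.

(** A representative of each class at which [x] does not vanish, from which the coefficient of that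
    class can be read off. *)
Variable J : nat -> nat.
Hypotheses (kJ : forall l, k (J l) = l) (xJ_neq0 : forall l, x (J l) != 0).

(** Norm approximation controls every coordinate, and one coordinate per class determines the
    coefficient there. *)
Lemma norm_closed_classwise_multiples (nlam : R^nat -> \bar R) (C : R) :
  0 < C -> (forall a j, lam a -> (nlam a <= 1)%E -> `|a j| <= C) ->
  norm_closed_in (@pi_space R lam E) (@pi_norm R lam nlam E) classwise_multiples.
Proof.
move=> C0 lamC z zpi zclose; split=> //.
have xJ l : 0 < `|x (J l)| by rewrite normr_gt0.
have /choice[f fP] l := positive_norming (x_ge0 (J l)).
(* Since [f l] norms [x (J l)], this formula returns [b l] whenever [z (J l) = b l *: x (J l)]. *)
pose a l : R := f l (z (J l)) / `|x (J l)|.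
(* [K] adds up two errors: that of the approximant at [j], and that of its coefficient, measured at
   [J l] and carried to [j]. It depends on neither [e] nor the approximant. *)
exists a => j; set l := k j; pose K := C * (1 + `|x j| / `|x (J l)|).
have K0 : 0 < K by rewrite mulr_gt0// ltr_pwDl// divr_ge0.
suff zK e : 0 < e -> `|z j - a l *: x j| <= e * K.
  apply/eqP; rewrite -subr_eq0 -normr_le0; apply/ler_addgt0Pr => e e0; rewrite add0r.
  by have := zK (e / K); rewrite divr_gt0// divfK ?gt_eqF//; exact.
move=> e0; have [_ [_ [b /funext ->]] zy] := zclose e e0.
have zb i : `|z i - b (k i) *: x i| <= C * e.
  have := @norm_coord_le_pi_norm _ lam nlam C E
    (z - (fun j => b (k j) *: x j)) i C0 (fun a => lamC a i).
  move=> /le_lt_trans/(_ zy); rewrite lte_fin ltr_pdivrMr// mulrC.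
  exact: ltW.
have ab : `|a l - b l| <= C * e / `|x (J l)|.
  have [_ f1 fx] := fP l.
  rewrite ler_pdivlMr// -[X in _ * X]normr_id -normrM mulrBl divfK ?gt_eqF//.
  have -> : f l (z (J l)) - b l * `|x (J l)| = f l (z (J l) - b l *: x (J l)).
    by rewrite linearB -fx; congr (_ - _); exact: esym (linearZ _ _).
  by apply: le_trans (f1 _) _; have := zb (J l); rewrite kJ.
have -> : z j - a l *: x j = (z j - b l *: x j) - (a l - b l) *: x j.
  by rewrite scalerBl opprB addrA subrK.
apply: le_trans (ler_normB _ _) _; rewrite normrZ.
have -> : e * K = C * e + C * e / `|x (J l)| * `|x j| by rewrite /K; ring.
by apply: lerD; [exact: zb | exact: ler_wpM2r].
Qed.

(** If [n] elements spanned, the restrictions of [x] to the first [n.+1] classes, read at the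
    representatives, would factor the identity matrix of size [n.+1] through dimension [n]. *)
Lemma infinite_dimensional_classwise_multiples :
  ~ finite_dimensional classwise_multiples.
Proof.
move=> [n [b [bL span]]].
have /choice[A bA] i : exists a, forall j, b i j = a (k j) *: x j.
  by have [_ [a ba]] := bL i; exists a.
have /choice[c cE] (l : 'I_n.+1) : exists c : 'I_n -> R,
    (fun j => (k j == l)%:R *: x j) = \sum_(i < n) c i *: b i.
  apply: span; apply: (@classwise_multiples_bounded (fun m => (m == l)%:R)) => m.
  by case: eqP => _; rewrite ?normr1 ?normr0.
have idE : (\matrix_(l < n.+1, i < n) c l i) *m (\matrix_(i < n, m < n.+1) A i m)
    = 1%:M.
  apply/matrixP => l m; rewrite !mxE.
  have := congr1 (@^~ (J m)) (cE l); rewrite fct_sumE kJ.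
  rewrite (eq_bigr (fun i => (c l i * A i m) *: x (J m))); last first.
    by move=> i _; rewrite fctE bA kJ scalerA.
  rewrite -scaler_suml => /eqP; rewrite -subr_eq0 -scalerBl scaler_eq0.
  rewrite (negPf (xJ_neq0 m)) orbF subr_eq0 eq_sym => /eqP sumE.
  by under eq_bigr do rewrite !mxE; rewrite sumE eq_sym.
have := mulmx_max_rank (\matrix_(l < n.+1, i < n) c l i)
  (\matrix_(i < n, m < n.+1) A i m).
by rewrite idE mxrank1 ltnn.
Qed.

End ClasswiseMultiples.

(** Stated for any scalar space with coordinates uniformly bounded on its unit ball, the property
    that lets the pi-norm control coordinates. *)
Theorem completely_latticeable_pi_minus_strong (nlam : R^nat -> \bar R) (C : R) :
  0 < C -> (forall a j, lam a -> (nlam a <= 1)%E -> `|a j| <= C) ->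
  @pi_space R lam E `\` @strong_space R lam E = set0 \/
  completely_latticeable (@pi_space R lam E) (@pi_norm R lam nlam E)
    (@pi_space R lam E `\` @strong_space R lam E).
Proof.
move=> C0 lamC; have [|/set0P[x0 [x0pi x0s]]] :=
  eqVneq (@pi_space R lam E `\` @strong_space R lam E) set0; first by left.
right; have [x [x_ge0 xpi xs]] := ge0_pi_minus_strong x0pi x0s.
have [f [fd fdiv]] : exists f : nat -> dual_space E, weak_dual lam f /\
    forall M, exists n, M < \sum_(0 <= j < n) `|f j (x j) : R|.
  apply: contrapT => nf; apply: xs; apply/strong_spaceP => f fd.
  apply: contrapT => nM; apply: nf; exists f; split=> // M.
  apply: contrapT => nn; apply: nM; exists M => n; rewrite leNgt.
  by apply/negP => ?; apply: nn; exists n.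
have [k kdiv] := divergent_partition (fun j => normr_ge0 (f j (x j) : R)) fdiv.
(* If [x] vanished on a class, the sum along it would be 0 and could not exceed 0. *)
have /choice[J JP] l : exists j, k j = l /\ x j != 0.
  apply: contrapT => nj; have [n] := kdiv l 0; rewrite big1 ?ltxx// => j /eqP kj.
  have [->|xj] := eqVneq (x j) 0; first by rewrite linear0 normr0.
  by exfalso; apply: nj; exists j.
have kJ l : k (J l) = l by have [] := JP l.
have xJ l : x (J l) != 0 by have [] := JP l.
exists (classwise_multiples x k); split.
- exact: classwise_multiples_sub.
- exact: riesz_subspace_classwise_multiples.
- exact: norm_closed_classwise_multiples kJ xJ _ _ C0 lamC.
- exact: infinite_dimensional_classwise_multiples kJ xJ.
move=> z [[zpi [a za]] z0]; split=> // /strong_spaceP/(_ f fd)[M zM].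
have [l al0] : exists l, a l != 0.
  apply: contrapT => na; apply: z0; apply/funext => j; rewrite za.
  have [->|aj] := eqVneq (a (k j)) 0; first by rewrite scale0r.
  by exfalso; apply: na; exists (k j).
(* On class [l] the terms for [z] are those for [x] times the absolute value of [a l], so a bound
   [M] for [z] would bound the divergent sum by this quotient. *)
have [n] := kdiv l (M / `|a l|); rewrite ltr_pdivrMr ?normr_gt0//.
apply/negP; rewrite -leNgt; apply: le_trans (zM n).
rewrite mulr_suml big_mkcond; apply: ler_sum => j _; case: eqP => [<-|//].
by rewrite za linearZ normrM mulrC.
Qed.

End PiMinusStrong.

(** * Orlicz spaces *)

(** Each term of a modular bounded by 1 is at most 1, whereas [phi] is at least 2 at some [T]; hence
    every coordinate is at most [T] times [rho]. *)
Lemma orlicz_norm_coord (R : realType) (phi : R -> R) : orlicz_function phi ->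
  exists2 C : R, 0 < C &
    forall a j, (orlicz_norm phi a <= 1)%E -> `|a j| <= C.
Proof.
move=> [_ mono _ phi0 /cvgryPge/(_ 2) phi2].
have [T T0 phiT] := pinfty_ex_gt (num_real 0) phi2.
exists (2 * T) => [|a j a1]; first by rewrite mulr_gt0.
(* A strict bound yields an admissible [rho] below 2 without asking whether the infimum is
   attained. *)
have a2 : (orlicz_norm phi a < 2%:E)%E.
  by apply: le_lt_trans a1 _; rewrite lte_fin ltr1n.
have [_ [rho [rho0 mod1] <-]] := ereal_inf_lt a2; rewrite lte_fin => rho2.
have in0 (t : R) : 0 <= t -> t \in `[0, +oo[ by rewrite in_itv /= andbT.
have arho i : 0 <= `|a i| / rho by rewrite divr_ge0// ltW.
have phi_ge0 i : 0 <= phi (`|a i| / rho).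
  by rewrite -phi0; apply: mono => //; exact: in0.
have phi1 : phi (`|a j| / rho) <= 1.
  rewrite -lee_fin; apply: le_trans mod1.
  apply: (le_trans _ (nneseries_lim_ge j.+1 _)); last first.
    by move=> i _ _; rewrite lee_fin.
  by rewrite sumEFin lee_fin big_nat_recr//= lerDr sumr_ge0.
have aT : `|a j| / rho <= T.
  rewrite leNgt; apply/negP => /ltW aT.
  have := mono _ _ (in0 _ (ltW T0)) (in0 _ (arho j)) aT.
  by lra.
move: aT; rewrite ler_pdivrMr// => /le_trans; apply.
by rewrite mulrC ler_pM2r// ltW.
Qed.

Theorem corollary3p8 (R : realType) (E : banachLatticeType R)
    (phi : R -> R)
    (hphi : orlicz_function phi) (hDelta2 : Delta2 phi)
    (hcompl : admits_complementary phi) :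
  orlicz_pi phi E `\` orlicz_s phi E = set0 \/
  completely_latticeable (orlicz_pi phi E) (orlicz_pi_norm phi E)
    (orlicz_pi phi E `\` orlicz_s phi E).
Proof.
have [C C0 phiC] := orlicz_norm_coord hphi.
by apply: (completely_latticeable_pi_minus_strong E C0) => a j _; exact: phiC.
Qed.
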